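(* Let $E,F$ be Banach spaces over $\mathbb{K}$. (i) Let $\mu:E\otimes F\to\mathbb{K}$ be a Grothendieck functional integral and define $\varphi_\mu:E\times F\to\mathbb{K}$ by $\varphi_\mu(e,f)=\mu(e\otimes f)$. Then $\varphi_\mu$ is a continuous bilinear form with $\|\varphi_\mu\|=\|\mu\|_G$. (ii) Conversely, for any continuous bilinear form $\varphi:E\times F\to\mathbb{K}$ satisfying $\|\varphi\|\le K_G$, there exists a unique Grothendieck functional integral $\mu$ such that $\varphi_\mu=\varphi$.
   Context: $\mathbb{K}$ is $\mathbb{R}$ or $\mathbb{C}$. The norm of a bilinear form $\varphi:E\times F\to\mathbb{K}$ is $\|\varphi\|=\sup\{|\varphi(e,f)|:\|e\|_E\le1,\|f\|_F\le1\}$. $K_G$ denotes Grothendieck's constant, taken to be the smallest constant with the following property (whose existence is taken as given, with the values $K_G^{\mathbb{R}}\approx1.778$ for the real field and $K_G^{\mathbb{C}}\approx1.338$ for the complex field): for arbitrary Banach spaces $E,F$ and any continuous bilinear form $\varphi:E\times F\to\mathbb{K}$ there exist a Hilbert space $H$ and bounded linear operators $A:E\to H$, $B:F\to H$ with $\varphi(e,f)=\langle Ae,Bf\rangle_H$ for all $e\in E$, $f\in F$, and $\|A\|\,\|B\|\le K_G\|\varphi\|$. On the algebraic tensor product $E\otimes F$, the projective norm is $\|u\|_\pi=\inf\{\sum_{i=1}^n\|e_i\|_E\|f_i\|_F: u=\sum_{i=1}^n e_i\otimes f_i\}$. A linear functional $\mu:E\otimes F\to\mathbb{K}$ is a Grothendieck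 functional integral if its operator norm $\|\mu\|$ with respect to $\|\cdot\|_\pi$ satisfies $\|\mu\|\le K_G$; then $\|\mu\|_G:=\|\mu\|$. *)

(* Defs.v *)
From HB Require Import structures.
From mathcomp Require Import all_boot all_order all_algebra.
From mathcomp Require Import complex.
From mathcomp Require Import all_classical all_reals all_analysis.
(* The notations of [monalg] clash with those of MathComp-Analysis:
   [malg X K] is the free [K]-module on [X], [mkmalgU x c] is [c] times the
   basis vector [x]. *)
From mathcomp Require Import -(notations) monalg.
Import numFieldNormedType.Exports.

Set Implicit Arguments.
Unset Strict Implicit.
Unset Printing Implicit Defensive.

Import Order.TTheory GRing.Theory Num.Theory.

Local Open Scope classical_set_scope.
Local Open Scope ring_scope.
Local Open Scope quotient_scope.

Variant scalar_kind := RealScalars | ComplexScalars.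

Definition scal (R : realType) (k : scalar_kind) : numFieldType :=
  match k with RealScalars => R | ComplexScalars => R[i] end.

Definition scal_re (R : realType) (k : scalar_kind) : scal R k -> R :=
  match k with RealScalars => id | ComplexScalars => @complex.Re R end.

Definition scal_conj (R : realType) (k : scalar_kind) : scal R k -> scal R k :=
  match k with
  | RealScalars => id
  | ComplexScalars => fun z : R[i] => z^*
  end.

(* Norms of a [normedModType K] take their values in [K]; this is the same
   norm with values in [R]. *)
Definition rnorm (R : realType) (k : scalar_kind)
    (V : normedModType (scal R k)) (v : V) : R := scal_re `|v|.

(** Algebraic tensor product: the free module on [E * F] modulo the submodule
    spanned by the bilinearity relators. *)
Section TensorProduct.
Variables (K : fieldType) (E F : lmodType K).

Let basis (e : E) (f : F) : malg (E * F)%type K := mkmalgU (e, f) 1.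

Inductive tensor_null : malg (E * F)%type K -> Prop :=
| tensor_nulll a e1 e2 f :
    tensor_null (basis (a *: e1 + e2) f - (a *: basis e1 f + basis e2 f))
| tensor_nullr a e f1 f2 :
    tensor_null (basis e (a *: f1 + f2) - (a *: basis e f1 + basis e f2))
| tensor_null0 : tensor_null 0
| tensor_null_comb a u v :
    tensor_null u -> tensor_null v -> tensor_null (a *: u + v).

Definition tensor_null_pred : {pred malg (E * F)%type K} :=
  fun w => `[< tensor_null w >].

Lemma tensor_null_zmod_closed : zmod_closed tensor_null_pred.
Proof.
split=> [|u v /asboolP hu /asboolP hv]; apply/asboolP.
  exact: tensor_null0.
by rewrite addrC -scaleN1r; apply: tensor_null_comb.
Qed.

HB.instance Definition _ :=
  GRing.isZmodClosed.Build _ tensor_null_pred tensor_null_zmod_closed.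

Definition tensor := Quotient.quot tensor_null_pred.

HB.instance Definition _ := GRing.Zmodule.on tensor.

Definition tensor_pi (w : malg (E * F)%type K) : tensor :=
  \pi_(Quotient.quot tensor_null_pred) w.

Definition tensor_scale (a : K) (u : tensor) : tensor :=
  tensor_pi (a *: repr (u : Quotient.quot tensor_null_pred)).

Lemma tensor_piP (u v : malg (E * F)%type K) :
  tensor_pi u = tensor_pi v <-> tensor_null (u - v).
Proof.
have h : ((u - v) \in tensor_null_pred) = (tensor_pi u == tensor_pi v).
  exact: Quotient.idealrBE.
by split=> [/eqP|huv]; [rewrite -h => /asboolP|apply/eqP; rewrite -h; apply/asboolP].
Qed.

Lemma tensor_piD : {morph tensor_pi : u v / u + v}.
Proof. by move=> u v; rewrite /tensor_pi raddfD. Qed.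

Lemma tensor_reprK (u : tensor) :
  tensor_pi (repr (u : Quotient.quot tensor_null_pred)) = u.
Proof. exact: reprK. Qed.

Lemma tensor_scaleE a w : tensor_scale a (tensor_pi w) = tensor_pi (a *: w).
Proof.
apply/tensor_piP; rewrite -scalerBr -[_ *: _]addr0.
apply: tensor_null_comb; last exact: tensor_null0.
by apply/tensor_piP; rewrite tensor_reprK.
Qed.

Lemma tensor_scaleA a b u :
  tensor_scale a (tensor_scale b u) = tensor_scale (a * b) u.
Proof. by rewrite -[u]tensor_reprK !tensor_scaleE scalerA. Qed.

Lemma tensor_scale1 : left_id 1 tensor_scale.
Proof. by move=> u; rewrite -[u]tensor_reprK tensor_scaleE scale1r. Qed.

Lemma tensor_scaleDr : right_distributive tensor_scale +%R.
Proof.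
move=> a u v; rewrite -[u]tensor_reprK -[v]tensor_reprK.
by rewrite -tensor_piD !tensor_scaleE -tensor_piD scalerDr.
Qed.

Lemma tensor_scaleDl u : {morph tensor_scale^~ u : a b / a + b}.
Proof.
by move=> a b; rewrite -[u]tensor_reprK !tensor_scaleE -tensor_piD scalerDl.
Qed.

HB.instance Definition _ := GRing.Zmodule_isLmodule.Build K tensor
  tensor_scaleA tensor_scale1 tensor_scaleDr tensor_scaleDl.

Definition tens (e : E) (f : F) : tensor := tensor_pi (basis e f).

End TensorProduct.

Section GrothendieckIntegrals.
Variables (R : realType) (k : scalar_kind).
Let K : numFieldType := scal R k.

Definition continuous_bilinear_form (E F : normedModType K)
    (phi : E -> F -> K) : Prop :=
  bilinear_for *%R *%R phi /\ continuous (fun p : E * F => phi p.1 p.2).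

(* Suprema are taken in [\bar R]: an unbounded form has norm [+oo]. *)
Definition form_norm (E F : normedModType K) (phi : E -> F -> K) : \bar R :=
  ereal_sup [set r | exists e f,
    [/\ rnorm e <= 1, rnorm f <= 1 & r = (scal_re `|phi e f|)%:E]].

Definition op_norm (E H : normedModType K) (A : E -> H) : \bar R :=
  ereal_sup [set (rnorm (A e))%:E | e in [set e | rnorm e <= 1]].

(* The inner product [dot] is linear on the left and conjugate-linear on the
   right, so over the complex numbers [phi] can only be bilinear if [B] is
   linear into the conjugate Hilbert space, that is, conjugate-linear into
   [H]. *)
Definition grothendieck_bound (C : R) : Prop :=
  forall (E F : completeNormedModType K) (phi : E -> F -> K),
    continuous_bilinear_form phi ->
    exists (H : completeNormedModType K) (dot : {dot H for @scal_conj R k})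
           (A : {linear E -> H}) (B : {linear F -> H | @scal_conj R k \; *:%R}),
      [/\ forall x : H, `|x| ^+ 2 = dot x x,
          (op_norm A < +oo)%E /\ (op_norm B < +oo)%E,
          forall e f, phi e f = dot (A e) (B f) &
          (op_norm A * op_norm B <= C%:E * form_norm phi)%E].

Definition smallest_grothendieck_bound (C : R) : Prop :=
  grothendieck_bound C /\ forall C', grothendieck_bound C' -> C <= C'.

(* The existence of a smallest bound is taken for granted, not assumed: for
   unrestricted Banach spaces the factorization fails (the duality pairing on
   [E * E^*] factors only when [E] is isomorphic to a Hilbert space), so an
   existence hypothesis would make any statement about it vacuous. *)
Definition is_grothendieck_constant (KG : R) : Prop :=
  forall C, smallest_grothendieck_bound C -> KG = C.

Section ProjectiveNorm.
Variables E F : completeNormedModType K.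

Definition proj_norm (u : tensor E F) : R :=
  inf [set r | exists s : seq (E * F),
    u = \sum_(p <- s) tens p.1 p.2 /\
    r = \sum_(p <- s) rnorm p.1 * rnorm p.2].

Definition functional_norm (mu : tensor E F -> K) : \bar R :=
  ereal_sup [set (scal_re `|mu u|)%:E | u in [set u | proj_norm u <= 1]].

Definition grothendieck_integral (KG : R) (mu : {scalar tensor E F}) : Prop :=
  (functional_norm mu <= KG%:E)%E.

Definition grothendieck_norm (mu : {scalar tensor E F}) : \bar R :=
  functional_norm mu.

Definition form_of (mu : {scalar tensor E F}) (e : E) (f : F) : K :=
  mu (tens e f).

End ProjectiveNorm.

End GrothendieckIntegrals.

(* Main.v *)
(** By the universal property of [tensor E F], linear functionals on it are the
    bilinear forms on [E * F], so everything reduces to the equality of the form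
    norm of [mu] and its functional norm. One inequality holds because [tens e f]
    has projective norm at most [rnorm e * rnorm f]; for the other,
    [|mu u| <= N * proj_norm u], with [N] the form norm, follows from the triangle
    inequality applied to each representation of [u] as a sum of elementary
    tensors. *)

Require Import Defs.
From HB Require Import structures.
From mathcomp Require Import all_boot all_order all_algebra.
From mathcomp Require Import sesquilinear complex.
From mathcomp Require Import all_classical all_reals all_analysis.
From mathcomp Require Import -(notations) monalg.
Import numFieldNormedType.Exports.
Import Order.TTheory GRing.Theory Num.Theory.
Local Open Scope classical_set_scope.
Local Open Scope ring_scope.

(** * Real numbers inside the scalar field *)

Section Scalars.
Context {R : realType} {k : scalar_kind}.
Implicit Types (x y : scal R k) (r s : R).

(** Norms take values in [scal R k], suprema and infima in [R]. This embedding is inverse to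
    [scal_re] on nonnegative scalars, so inequalities between norms can be moved from one side to
    the other. *)
Definition scal_of : R -> scal R k :=
  match k return R -> scal R k with
  | RealScalars => id
  | ComplexScalars => fun r => (r +i* 0)%C
  end.

Lemma scal_ofK : cancel scal_of (@scal_re R k).
Proof. by rewrite /scal_of; case: (k). Qed.

Lemma scal_reK x : 0 <= x -> scal_of (scal_re x) = x.
Proof.
rewrite /scal_of; case: (k) x => //= -[a b].
by rewrite lecE /= => /andP[/eqP <- _].
Qed.

Lemma ler_scal_of : {mono scal_of : r s / r <= s}.
Proof. by move=> r s; rewrite /scal_of; case: (k) => //; rewrite lecR. Qed.

Lemma scal_of0 : scal_of 0 = 0.
Proof. by rewrite /scal_of; case: (k). Qed.

Lemma scal_of1 : scal_of 1 = 1.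
Proof. by rewrite /scal_of; case: (k). Qed.

Lemma scal_ofD : {morph scal_of : r s / r + s}.
Proof.
by move=> r s; rewrite /scal_of; case: (k) => //; exact: (rmorphD (real_complex R)).
Qed.

Lemma scal_ofM : {morph scal_of : r s / r * s}.
Proof.
by move=> r s; rewrite /scal_of; case: (k) => //; exact: (rmorphM (real_complex R)).
Qed.

Lemma scal_of_sum (I : Type) (t : seq I) (G : I -> R) :
  scal_of (\sum_(i <- t) G i) = \sum_(i <- t) scal_of (G i).
Proof. exact: (big_morph _ scal_ofD scal_of0). Qed.

Lemma rnormK (V : normedModType (scal R k)) (v : V) :
  scal_of (rnorm v) = `|v|.
Proof. exact: scal_reK. Qed.

Lemma rnorm_ge0 (V : normedModType (scal R k)) (v : V) : 0 <= rnorm v.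
Proof. by rewrite -ler_scal_of rnormK scal_of0. Qed.

End Scalars.

(** Uniqueness of the functional is an equality of bundled maps. The bundled proofs of additivity
    and homogeneity agree by proof irrelevance. *)
Lemma linear_funext (K : pzRingType) (U : lmodType K) (V : zmodType)
    (s : K -> V -> V) (f g : {linear U -> V | s}) : (f : U -> V) = g -> f = g.
Proof.
case: f g => f [[f1] [f2]] [g [[g1] [g2]]] /= fg; rewrite -{}fg in g1 g2 *.
by rewrite (Prop_irrelevance f1 g1) (Prop_irrelevance f2 g2).
Qed.

(** * Universal property of the tensor product *)

Section TensorTheory.
Context {K : fieldType} {E F : lmodType K}.

Lemma tensor_piZ a (w : malg (E * F)%type K) :
  tensor_pi (a *: w) = a *: tensor_pi w.
Proof. by rewrite -tensor_scaleE. Qed.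

Lemma tens_linearl (f : F) : linear (fun e : E => tens e f).
Proof.
move=> a e1 e2; rewrite /tens -tensor_piZ -tensor_piD.
exact/tensor_piP/tensor_nulll.
Qed.

Lemma tens_linearr (e : E) : linear (fun f : F => tens e f).
Proof.
move=> a f1 f2; rewrite /tens -tensor_piZ -tensor_piD.
exact/tensor_piP/tensor_nullr.
Qed.

Lemma tens0l (f : F) : tens (0 : E) f = 0.
Proof.
have := tens_linearl f 1 0 0.
by rewrite !scale1r addr0 -[LHS]addr0 => /addrI.
Qed.

Lemma tensZl a (e : E) (f : F) : tens (a *: e) f = a *: tens e f.
Proof. by rewrite -[a *: e]addr0 tens_linearl tens0l addr0. Qed.

Lemma tensor_pi_sum (w : malg (E * F)%type K) :
  tensor_pi w = \sum_(p <- finmap.enum_fset (msupp w)) tens (mcoeff p w *: p.1) p.2.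
Proof.
rewrite [in LHS](monalgE w).
have pi0 : tensor_pi (0 : malg (E * F)%type K) = 0 by rewrite /tensor_pi raddf0.
rewrite (big_morph _ (@tensor_piD K E F) pi0); apply: eq_bigr => -[e f] _.
rewrite tensZl -tensor_piZ; congr tensor_pi.
by apply/malgP => p; rewrite mcoeffZ !mcoeffU mulr_natr.
Qed.

(** Coefficients are absorbed into the left factors, which gives the coefficient-free sums used in
    [proj_norm]. The infimum there is thus over a nonempty set. *)
Lemma tensor_sum (u : tensor E F) :
  exists s : seq (E * F), u = \sum_(p <- s) tens p.1 p.2.
Proof.
set w := repr (u : Quotient.quot (@tensor_null_pred K E F)).
exists [seq (mcoeff p w *: p.1, p.2) | p <- finmap.enum_fset (msupp w)].
by rewrite -[LHS]tensor_reprK tensor_pi_sum big_map.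
Qed.

Lemma tensor_scalar_ext (mu nu : {scalar tensor E F}) :
  (forall e f, mu (tens e f) = nu (tens e f)) -> mu = nu.
Proof.
move=> munu; apply/linear_funext/funext => u.
have [s ->] := tensor_sum u; rewrite !linear_sum.
by apply: eq_bigr => p _; exact: munu.
Qed.

Section Lift.
Context {phi : E -> F -> K} (phi_bilin : bilinear_for *%R *%R phi).

Definition free_lift : malg (E * F)%type K -> K :=
  mmap (fun c : K => c) (fun p => phi p.1 p.2).

Lemma free_lift_scalar : scalar free_lift.
Proof.
move=> a u v; rewrite /free_lift (mmapD (f := idfun)); congr (_ + _).
(* The support of [a *: u] may shrink when [a = 0], so both sums run over the support of [u]. *)
rewrite (mmapEw (f := idfun) (msuppZ_le _ _)) mmapE big_distrr /=.
by apply: eq_bigr => p _; rewrite mcoeffZ mulrA.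
Qed.

Lemma free_lift_basis e f : free_lift (mkmalgU (e, f) 1) = phi e f.
Proof. by rewrite /free_lift (mmapU (f := idfun)) /= mul1r. Qed.

HB.instance Definition _ :=
  GRing.isLinear.Build K (malg (E * F)%type K) K *%R free_lift free_lift_scalar.

Lemma free_lift_null w : tensor_null w -> free_lift w = 0.
Proof.
elim=> [a e1 e2 f|a e f1 f2||a u v _ u0 _ v0].
- by rewrite linearB scalarP /= !free_lift_basis phi_bilin.1 subrr.
- by rewrite linearB scalarP /= !free_lift_basis phi_bilin.2 subrr.
- exact: linear0.
- by rewrite scalarP /= u0 v0 mulr0 addr0.
Qed.

(** The value at a chosen representative; the choice is immaterial because [free_lift] kills the
    relators. *)
Definition bilinear_lift (u : tensor E F) : K :=
  free_lift (repr (u : Quotient.quot (@tensor_null_pred K E F))).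

Lemma bilinear_lift_tensor_pi w : bilinear_lift (tensor_pi w) = free_lift w.
Proof.
apply/eqP; rewrite -subr_eq0 -linearB; apply/eqP/free_lift_null/tensor_piP.
by rewrite tensor_reprK.
Qed.

Lemma bilinear_lift_scalar : scalar bilinear_lift.
Proof.
move=> a u v; rewrite -[u]tensor_reprK -[v]tensor_reprK.
by rewrite -tensor_piZ -tensor_piD !bilinear_lift_tensor_pi scalarP.
Qed.

HB.instance Definition _ :=
  GRing.isLinear.Build K (tensor E F) K *%R bilinear_lift bilinear_lift_scalar.

Lemma tensor_lift :
  exists mu : {scalar tensor E F}, forall e f, mu (tens e f) = phi e f.
Proof.
exists (bilinear_lift : {scalar tensor E F}) => e f.
exact: etrans (bilinear_lift_tensor_pi _) (free_lift_basis _ _).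
Qed.

End Lift.

Lemma bilinear_of_tensor (mu : {scalar tensor E F}) :
  bilinear_for *%R *%R (fun e f => mu (tens e f)).
Proof.
split=> [f a e1 e2|e a f1 f2] /=.
  by rewrite tens_linearl scalarP.
by rewrite tens_linearr scalarP.
Qed.

End TensorTheory.

(** * Boundedness and continuity of bilinear forms *)

Section BoundedForms.
Context {R : realType} {k : scalar_kind} {E F : normedModType (scal R k)}.
Local Notation K := (scal R k).
Context {phi : E -> F -> K} (phi_bilin : bilinear_for *%R *%R phi).

HB.instance Definition _ :=
  bilinear_isBilinear.Build K E F K *%R *%R phi phi_bilin.

Lemma form_norm_ge0 : (0 <= form_norm phi)%E.
Proof.
apply: ereal_sup_ubound; exists 0, 0; rewrite linear0l normr0.
have rnorm0 (V : normedModType K) : rnorm (0 : V) <= 1.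
  by rewrite -(ler_scal_of (k := k)) rnormK normr0 scal_of1.
split=> //; congr EFin; apply: (can_inj (scal_ofK (k := k))).
by rewrite scal_reK// scal_of0.
Qed.

(** Homogeneity in each variable reduces to unit vectors; zero vectors, which cannot be normalised,
    are treated first. *)
Lemma form_norm_bound (N : R) : (form_norm phi <= N%:E)%E ->
  forall e f, `|phi e f| <= scal_of N * `|e| * `|f|.
Proof.
move=> phiN e f.
have [->|e0] := eqVneq e 0; first by rewrite linear0l !normr0 mulr0 mul0r.
have [->|f0] := eqVneq f 0; first by rewrite linear0r !normr0 mulr0.
have unit_norm (V : normedModType K) (v : V) : v != 0 -> rnorm (`|v|^-1 *: v) <= 1.
  move=> v0; rewrite -(ler_scal_of (k := k)) rnormK scal_of1 normrZ.
  by rewrite normfV normr_id mulVf// normr_eq0.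
have : (scal_re `|phi (`|e|^-1 *: e) (`|f|^-1 *: f)| <= N).
  rewrite -lee_fin; apply: le_trans phiN; apply: ereal_sup_ubound.
  by exists (`|e|^-1 *: e), (`|f|^-1 *: f); split=> //; exact: unit_norm.
rewrite -(ler_scal_of (k := k)) scal_reK// linearZl_LR linearZr_LR !normrM.
rewrite !normfV !normr_id => h.
have e_gt0 : 0 < `|e| by rewrite normr_gt0.
have f_gt0 : 0 < `|f| by rewrite normr_gt0.
by rewrite -ler_pdivrMr// -ler_pdivrMr// mulrC (mulrC `|phi e f|).
Qed.

Lemma bounded_form_continuous (C : K) : 0 <= C ->
  (forall e f, `|phi e f| <= C * `|e| * `|f|) ->
  continuous (fun p : E * F => phi p.1 p.2).
Proof.
move=> C_ge0 phiC [e0 f0]; apply/cvgrPdist_le => eps eps_gt0 /=.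
(* Within distance [d = eps / M] of [(e0, f0)], and with [|p.2| <= |f0| + 1], the two terms of the
   splitting below are at most [C * |e0| * d] and [C * d * (|f0| + 1)]. The final [+ 1] keeps [M]
   positive even if [C = 0]. *)
pose M := C * (`|e0| + `|f0| + 1) + 1.
have M_gt0 : 0 < M by rewrite ltr_wpDl// mulr_ge0// !addr_ge0.
have d_gt0 : 0 < eps / M by exact: divr_gt0.
near=> p.
have pe : `|e0 - p.1| <= eps / M.
  by near: p; apply: (cvgr_dist_le fst) d_gt0; exact: cvg_fst.
have pf : `|f0 - p.2| <= eps / M.
  by near: p; apply: (cvgr_dist_le snd) d_gt0; exact: cvg_snd.
have pf1 : `|p.2| <= `|f0| + 1.
  near: p; apply: (cvgr_norm_le (f := snd) f0); first exact: cvg_snd.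
  by rewrite ltrDl.
have -> : phi e0 f0 - phi p.1 p.2 = phi e0 (f0 - p.2) + phi (e0 - p.1) p.2.
  by rewrite linearBr linearBl addrA subrK.
apply: le_trans (ler_normD _ _) _.
apply: le_trans (lerD (phiC _ _) (phiC _ _)) _.
apply: (@le_trans _ _ (C * (`|e0| + `|f0| + 1) * (eps / M))).
  rewrite -!mulrA -mulrDr ler_wpM2l// -addrA mulrDl lerD ?ler_wpM2l//.
  by rewrite mulrC ler_pM.
rewrite mulrCA ger_pMr// ler_pdivrMr// mul1r.
by rewrite lerDl.
Unshelve. all: by end_near.
Qed.

End BoundedForms.

(** * The projective norm and the equality of the two norms *)

Section ProjectiveNorm.
Context {R : realType} {k : scalar_kind} {E F : completeNormedModType (scal R k)}.
Implicit Types (u : tensor E F) (mu : {scalar tensor E F}).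

Let costs u : set R := [set r | exists s : seq (E * F),
  u = \sum_(p <- s) tens p.1 p.2 /\
  r = \sum_(p <- s) rnorm p.1 * rnorm p.2].

Let costs_ge0 u : lbound (costs u) 0.
Proof.
by move=> _ [s [_ ->]]; apply: sumr_ge0 => p _; rewrite mulr_ge0 ?rnorm_ge0.
Qed.

Lemma proj_norm_tens (e : E) (f : F) : proj_norm (tens e f) <= rnorm e * rnorm f.
Proof.
apply: (ge_inf (E := costs (tens e f))); first by exists 0; exact: costs_ge0.
by exists [:: (e, f)]; rewrite !big_seq1.
Qed.

Lemma proj_norm_bound mu (N : R) : 0 <= N ->
  (forall e f, `|mu (tens e f)| <= scal_of N * `|e| * `|f|) ->
  forall u, scal_re `|mu u| <= N * proj_norm u.
Proof.
move=> N_ge0 muN u.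
have cost_bound r : costs u r -> scal_re `|mu u| <= N * r.
  move=> [s [-> ->]]; rewrite -(ler_scal_of (k := k)) scal_reK//.
  rewrite scal_ofM scal_of_sum linear_sum mulr_sumr.
  apply: le_trans (ler_norm_sum _ _ _) _; apply: ler_sum => p _.
  by rewrite scal_ofM !rnormK mulrA.
have [s us] := tensor_sum u.
have costsN0 : costs u !=set0 by eexists; exists s.
(* For [N > 0], dividing by [N] makes [|mu u| / N] a lower bound of the costs. For [N = 0], any
   single representation already gives [|mu u| <= 0]. *)
have [N0|N_neq0] := eqVneq N 0.
  by have [r /cost_bound] := costsN0; rewrite N0 !mul0r.
have N_gt0 : 0 < N by rewrite lt_neqAle eq_sym N_neq0.
rewrite mulrC -ler_pdivrMr//; apply: lb_le_inf => // r /cost_bound.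
by rewrite ler_pdivrMr// mulrC.
Qed.

Lemma form_norm_of mu : form_norm (form_of mu) = functional_norm mu.
Proof.
apply/eqP; rewrite eq_le; apply/andP; split.
  apply: ge_ereal_sup => _ [e [f [e1 f1 ->]]]; apply: ereal_sup_ubound.
  exists (tens e f) => //=; apply: le_trans (proj_norm_tens e f) _.
  by rewrite mulr_ile1 ?rnorm_ge0.
have norm_ge0 := form_norm_ge0 (bilinear_of_tensor mu).
apply: ge_ereal_sup => _ [u u1 <-].
(* The value [+oo] bounds everything, and [-oo] is excluded by nonnegativity. *)
case E1 : (form_norm (form_of mu)) norm_ge0 => [N||]; [|by rewrite !leey|by []].
rewrite !lee_fin => N_ge0.
have /proj_norm_bound : forall e f, `|mu (tens e f)| <= scal_of N * `|e| * `|f|.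
  apply: form_norm_bound; first exact: bilinear_of_tensor.
  by rewrite -E1.
move=> /(_ N_ge0 u)/le_trans; apply.
by rewrite -[leRHS]mulr1 ler_wpM2l.
Qed.

End ProjectiveNorm.

Theorem proposition3p2 (R : realType) (k : scalar_kind) (KG : R)
    (hKG : is_grothendieck_constant k KG)
    (E F : completeNormedModType (scal R k)) :
  (forall mu : {scalar tensor E F},
      grothendieck_integral KG mu ->
      continuous_bilinear_form (form_of mu) /\
      form_norm (form_of mu) = grothendieck_norm mu) /\
  (forall phi : E -> F -> scal R k,
      continuous_bilinear_form phi ->
      (form_norm phi <= KG%:E)%E ->
      exists! mu : {scalar tensor E F},
        grothendieck_integral KG mu /\ form_of mu = phi).
Proof.
split=> [mu muKG|phi [phi_bilin _] phiKG].
  split; last exact: form_norm_of.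
  split; first exact: bilinear_of_tensor.
  (* The sign of [KG] comes from the chain 0 <= form norm = functional norm <= [KG]. *)
  have KG_ge0 : 0 <= KG.
    rewrite -lee_fin; apply: le_trans (form_norm_ge0 (bilinear_of_tensor mu)) _.
    by rewrite form_norm_of.
  apply: (bounded_form_continuous (bilinear_of_tensor mu) (scal_of KG)).
    by rewrite -scal_of0 ler_scal_of.
  apply: (form_norm_bound (bilinear_of_tensor mu)).
  by rewrite form_norm_of.
have [mu muE] := tensor_lift phi_bilin.
have form_mu : form_of mu = phi by apply/funext => e; apply/funext => f; exact: muE.
exists mu; split=> [|nu [_ form_nu]].
  by split=> //; rewrite /grothendieck_integral -form_norm_of form_mu.
(* Elementary tensors span, so the form determines the functional. *)
apply: tensor_scalar_ext => e f.
by rewrite muE -form_nu.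
Qed.
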